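(* Let $d\ge n\ge 1$ be integers and let $T=(\tau_1,\dots,\tau_d)$ be the list with $\tau_1=\dots=\tau_n=1$ and $\tau_{n+1}=\dots=\tau_d=0$. Then $1$-out-of-$d$ MMS allocations exist for all fair division instances with $n$ agents and additive valuations if and only if $T$-MMS allocations exist for all fair division instances with $d$ agents and additive valuations.
   Context: A fair division instance consists of agents $\{1,\dots,q\}$, a finite set $M$ of indivisible goods, and additive valuations $v_i:2^M\to\mathbb{R}_{\ge0}$. For a positive integer $d$, $\mathrm{MMS}_i^d(M)$ is the maximum, over partitions $(P_1,\dots,P_d)$ of $M$ into $d$ (possibly empty) bundles, of $\min_j v_i(P_j)$. An allocation is a partition $(X_1,\dots,X_q)$ of $M$ into possibly empty bundles. An allocation in an instance with $n$ agents is $1$-out-of-$d$ MMS if $v_i(X_i)\ge\mathrm{MMS}_i^d(M)$ for all $i\in\{1,\dots,n\}$. For an instance with $d$ agents where agent $i$ has priority rank $i$, and for thresholds $1\ge\tau_1\ge\dots\ge\tau_d\ge0$, an allocation is $T$-MMS if $v_i(X_i)\ge\tau_i\cdot\mathrm{MMS}_i^d(M)$ for all $i\in\{1,\dots,d\}$. *)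

(* Defs.v *)
From mathcomp Require Import all_boot all_order all_algebra.
From mathcomp Require Import reals.

Set Implicit Arguments.
Unset Strict Implicit.
Unset Printing Implicit Defensive.

Import Order.TTheory GRing.Theory Num.Theory.
Local Open Scope ring_scope.

Definition additive_valuation (R : realType) (M : finType)
    (v : {set M} -> R) : Prop :=
  (forall S : {set M}, 0 <= v S) /\
  (forall S : {set M}, v S = \sum_(g in S) v [set g]).

(* Ordered and allowing empty bundles, unlike [finset.partition]. *)
Definition is_partition (q : nat) (M : finType)
    (X : {ffun 'I_q -> {set M}}) : bool :=
  (\bigcup_(i < q) X i == [set: M]) &&
  [forall i, forall j, (i != j) ==> [disjoint X i & X j]].

(* For an additive valuation and d > 0, the default values are harmless:
   v [set: M] bounds every v (P j) from above, and 0 bounds every minimum from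
   below, so these are the genuine minimum and maximum. *)
Definition min_bundle (R : realType) (M : finType) (d : nat)
    (v : {set M} -> R) (P : {ffun 'I_d -> {set M}}) : R :=
  \big[Num.min/v [set: M]]_(j < d) v (P j).

Definition MMS (R : realType) (M : finType) (d : nat) (v : {set M} -> R) : R :=
  \big[Num.max/0]_(P : {ffun 'I_d -> {set M}} | is_partition P) min_bundle v P.

Definition one_out_of_MMS (R : realType) (M : finType) (n d : nat)
    (v : 'I_n -> {set M} -> R) (X : {ffun 'I_n -> {set M}}) : Prop :=
  is_partition X /\ forall i : 'I_n, MMS d (v i) <= v i (X i).

(* Agents are indexed from 0, so the agent of priority rank k is the ordinal of
   value k - 1. *)
Definition threshold_MMS (R : realType) (M : finType) (d : nat)
    (tau : 'I_d -> R) (v : 'I_d -> {set M} -> R)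
    (X : {ffun 'I_d -> {set M}}) : Prop :=
  is_partition X /\ forall i : 'I_d, tau i * MMS d (v i) <= v i (X i).

Definition one_out_of_MMS_exist (R : realType) (n d : nat) : Prop :=
  forall (M : finType) (v : 'I_n -> {set M} -> R),
    (forall i, additive_valuation (v i)) ->
    exists X : {ffun 'I_n -> {set M}}, one_out_of_MMS d v X.

Definition threshold_list (R : realType) (d : nat) (tau : 'I_d -> R) : Prop :=
  (forall i, 0 <= tau i <= 1) /\
  (forall i j : 'I_d, (i <= j)%N -> tau j <= tau i).

Definition threshold_MMS_exist (R : realType) (d : nat) (tau : 'I_d -> R) :
    Prop :=
  forall (M : finType) (v : 'I_d -> {set M} -> R),
    (forall i, additive_valuation (v i)) ->
    exists X : {ffun 'I_d -> {set M}}, threshold_MMS tau v X.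

Definition ones_then_zeros (R : realType) (n d : nat) (i : 'I_d) : R :=
  if (i < n)%N then 1 else 0.

Lemma ones_then_zeros_threshold_list (R : realType) (n d : nat) :
  threshold_list (@ones_then_zeros R n d).
Proof.
split=> [i|i j le_ij]; rewrite /ones_then_zeros.
  by case: ifP => _; rewrite ?lexx ?ler01.
case: (ltnP j n) => [lt_jn|_]; first by rewrite (leq_ltn_trans le_ij lt_jn).
by case: ifP.
Qed.

(* Main.v *)
(* Push the bundles of an allocation forward along a map of agents: the result
   is again an allocation, and every agent's bundle is contained in that of its
   image. The embedding of the [n] agents into the [d] agents gives one
   direction; collapsing the [d - n] unconstrained agents onto an arbitrary one
   of the [n] agents gives the other. *)
Require Import Defs.
From mathcomp Require Import all_boot all_order all_algebra.
From mathcomp Require Import reals.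

Import Order.TTheory GRing.Theory Num.Theory.

Lemma additive_valuation_mono {R : realType} {M : finType} (v : {set M} -> R)
    (A B : {set M}) :
  additive_valuation v -> A \subset B -> (v A <= v B)%R.
Proof.
case=> v_ge0 v_add sAB; rewrite (v_add B) (big_setID A) /= (setIidPr sAB).
by rewrite -v_add lerDl sumr_ge0.
Qed.

(** Agents outside the image of [h] receive the empty bundle. *)
Definition push_bundles {M : finType} {q r : nat} (h : 'I_q -> 'I_r)
    (X : {ffun 'I_q -> {set M}}) : {ffun 'I_r -> {set M}} :=
  [ffun i => \bigcup_(j | h j == i) X j].

Lemma sub_push_bundles {M : finType} {q r : nat} (h : 'I_q -> 'I_r)
    (X : {ffun 'I_q -> {set M}}) (j : 'I_q) :
  X j \subset push_bundles h X (h j).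
Proof. by rewrite ffunE; apply: bigcup_sup. Qed.

Lemma push_bundles_partition {M : finType} {q r : nat} (h : 'I_q -> 'I_r)
    (X : {ffun 'I_q -> {set M}}) :
  is_partition X -> is_partition (push_bundles h X).
Proof.
case/andP=> /eqP coverX /forallP disjX; apply/andP; split.
  rewrite -subTset -coverX; apply/bigcupsP=> j _.
  by rewrite (subset_trans (sub_push_bundles h X j)) ?bigcup_sup.
apply/forallP=> i; apply/forallP=> i'; apply/implyP=> neq_ii'.
(* Fibres of [h] over distinct agents share no index, so only bundles of distinct agents are
   compared. *)
rewrite !ffunE bigcup_disjoint // => j' /eqP hj'.
rewrite disjoint_sym bigcup_disjoint // => j /eqP hj.
apply: (implyP (forallP (disjX j') j)).
by apply: contra neq_ii' => /eqP eq_j; rewrite -hj -hj' eq_j.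
Qed.

Theorem lemma1 (R : realType) (n d : nat) (hn : (1 <= n)%N) (hnd : (n <= d)%N) :
  one_out_of_MMS_exist R n d <->
  threshold_MMS_exist (@ones_then_zeros R n d).
Proof.
split=> [exX M v addv|exX M v addv].
  have [//|X [partX mmsX]] := exX M (fun i => v (widen_ord hnd i)).
  exists (push_bundles (widen_ord hnd) X).
  split=> [|i]; first exact: push_bundles_partition.
  (* From index [n] on the threshold is 0, and nonnegativity of the valuation is enough. *)
  rewrite /ones_then_zeros; case: ifP => [lt_in|_]; last first.
    by rewrite mul0r; case: (addv i).
  have -> : i = widen_ord hnd (Ordinal lt_in) by apply: val_inj.
  rewrite mul1r (le_trans (mmsX _)) // additive_valuation_mono //.
  exact: sub_push_bundles.
(* [insubd] fixes the indices below [n] and sends all others to its default, agent 0, which exists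
   by [hn]. *)
pose h (j : 'I_d) : 'I_n := insubd (Ordinal hn) (val j).
have hK i : h (widen_ord hnd i) = i by rewrite /h valKd.
(* The [d - n] added agents copy the valuation of agent 0. [MMS] has the same [d] on both sides, so
   the bounds of the first [n] agents transfer unchanged. *)
have [//|X [partX mmsX]] := exX M (fun j => v (h j)).
exists (push_bundles h X); split=> [|i]; first exact: push_bundles_partition.
have := mmsX (widen_ord hnd i); rewrite /ones_then_zeros /= ltn_ord mul1r hK.
move/le_trans; apply; apply: additive_valuation_mono => //.
by rewrite -{2}(hK i) sub_push_bundles.
Qed.
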